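(* Let $q$ be an odd positive integer, $p>q$ a prime, and $a\in(\mathbb{Z}/pq\mathbb{Z})^*$ with $a^{(p-1)/2}\equiv-1\pmod{pq}$ and such that $\alpha:=a\bmod p$ generates $\mathbb{F}_p^*$. Let $\beta:=a\bmod q\in(\mathbb{Z}/q\mathbb{Z})^*$ and $n=\mathrm{ord}(\beta)$ (so $n\mid p-1$). Let $\psi:\langle\beta\rangle\to\mu_n$, $\beta^j\mapsto e^{2\pi \mathbf{i} j/n}$, and let $\chi$ be the character of $\mathbb{F}_p^*$ given by $\chi(\alpha^j)=e^{2\pi\mathbf{i} j/n}$. Let $B=\{b\in\langle\beta\rangle : b-1\in\langle\beta\rangle\}$ and, for $1\le i,j\le n-1$, $c_{i,j}=\sum_{b\in B}\psi(b)^{-i}\psi(1-b)^{-j}$. Then, with $S=S_{pq}(a)$, $$|S\cap(S+1)|=\frac{1}{n^2}\Big((p+1)|B|+\sum_{1\le i\le j<n-i}2(2-\delta_{i,j})\,\mathrm{Re}\big(c_{i,j}J(\chi^i,\chi^j)\big)\Big),$$ where $\delta_{i,j}$ is the Kronecker delta.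
   Context: $S_{pq}(a)=\{a^j:0\le j<p-1\}\subseteq\mathbb{Z}/pq\mathbb{Z}$, $S+1=\{s+1:s\in S\}$, $\mu_n$ is the group of complex $n$-th roots of unity. A character mod $p$ is a homomorphism $\chi:\mathbb{F}_p^*\to\mathbb{C}^*$; it is extended to $\mathbb{F}_p$ by $\chi(0)=0$ if $\chi$ is nontrivial and $\chi(0)=1$ if $\chi$ is trivial. For characters $\chi,\lambda$ mod $p$ the Jacobi sum is $J(\chi,\lambda)=\sum_{c,d\in\mathbb{F}_p,\,c+d=1}\chi(c)\lambda(d)$. $\mathbf{i}=\sqrt{-1}$.
   Formalization: The case q = 1 is excluded (q > 1 is assumed), because there the formula is false: n = 1, |B| = 1, the sum is empty and the right side is p+1, while |S ∩ (S+1)| = p−2 for odd p (0 for p = 2). *)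

(* Defs.v *)
From HB Require Import structures.
From mathcomp Require Import all_boot all_order all_algebra all_field.
From mathcomp Require Import complex.
From mathcomp Require Import reals trigo Rstruct.
Set Implicit Arguments. Unset Strict Implicit. Unset Printing Implicit Defensive.
Import Order.TTheory GRing.Theory Num.Theory.
Local Open Scope ring_scope.

Notation C := (complex Rdefinitions.R).

Definition zeta (n : nat) : C :=
  (cos (2 * pi / n%:R) +i* sin (2 * pi / n%:R))%C.

Definition Spq (p q : nat) (a : 'Z_(p * q)) : {set 'Z_(p * q)} :=
  [set a ^+ j | j : 'I_(p.-1)].

Definition shift1 (m : nat) (S : {set 'Z_m}) : {set 'Z_m} := [set s + 1 | s in S].

Definition cyc (q n : nat) (b : 'Z_q) : {set 'Z_q} := [set b ^+ j | j : 'I_n].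

Definition psi (q n : nat) (beta : 'Z_q) (b : 'Z_q) : C :=
  if [pick j : 'I_n | beta ^+ j == b] is Some j then zeta n ^+ j else 0.

Definition chi (p n : nat) (alpha : 'F_p) (x : 'F_p) : C :=
  if [pick j : 'I_(p.-1) | alpha ^+ j == x] is Some j then zeta n ^+ j else 0.

(* The power chi^i of a character of F_p^*, extended to F_p by the convention
   chi^i(0) = 0 if chi^i is nontrivial and chi^i(0) = 1 if it is trivial. *)
Definition charpow (p : nat) (X : 'F_p -> C) (i : nat) (x : 'F_p) : C :=
  if x == 0 then
    (if [forall y : 'F_p, (y != 0) ==> (X y ^+ i == 1)] then 1 else 0)
  else X x ^+ i.

Definition jacobi (p : nat) (X L : 'F_p -> C) : C :=
  \sum_(c : 'F_p) X c * L (1 - c).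

(* Main.v *)
Require Import Defs.
From HB Require Import structures.
From mathcomp Require Import all_boot all_order all_algebra all_field.
From mathcomp Require Import complex.
From mathcomp Require Import reals trigo Rstruct.
From mathcomp Require Import zify ring lra.
Import Order.TTheory GRing.Theory Num.Theory.
Local Open Scope ring_scope.

(** Reduction mod p and mod q identifies S with the pairs (x, b), x in F_p^* and
    b in <beta>, such that chi(x) = psi(b); since -1 lies in S, the elements of
    S :&: (S + 1) are the pairs with b in B, chi(x) = psi(b) and
    chi(1 - x) = psi(1 - b).  Detecting both equalities by orthogonality of the
    n-th roots of unity gives n^-2 times the sum over 0 <= i, j < n of
    c(i, j) J(chi^i, chi^j), with J restricted to x <> 0, 1.  The term i = j = 0
    is (p - 2)|B|, and the families i = 0, j = 0 and i + j = n contribute |B|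
    each.  Complex conjugation exchanges (i, j) with (n - i, n - j), so the rest
    is twice the real part of the sum over i + j < n, which is symmetric in i, j
    because b |-> 1 - b is an involution of B. *)

(** * Powers of roots of unity, and sums over a triangle of indices *)

Lemma unity_neq0 (K : fieldType) (n : nat) (w : K) :
  (0 < n)%N -> w ^+ n = 1 -> w != 0.
Proof.
move=> n_gt0 wn; apply/eqP => h; move: wn; rewrite h expr0n eqn0Ngt n_gt0.
by move/eqP; rewrite eq_sym oner_eq0.
Qed.

Lemma sum_unity_powers (K : fieldType) (n : nat) (w : K) :
  w ^+ n = 1 -> \sum_(i < n) w ^+ i = if w == 1 then n%:R else 0.
Proof.
move=> wn; case: eqP => [->|/eqP w1].
  by under eq_bigr do rewrite expr1n; rewrite sumr_const card_ord.
have /eqP := subrX1 w n; rewrite wn subrr eq_sym mulf_eq0 subr_eq0 (negPf w1).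
by move=> /eqP.
Qed.

(** The full geometric sum vanishes, so dropping its term 1 at [i = 0] leaves -1. The factor
    [(n != 0)%:R] covers [n = 0], where the range is empty. *)
Lemma sum_unity_powers_pos (K : fieldType) (n : nat) (w : K) :
  w ^+ n = 1 -> w != 1 -> \sum_(1 <= i < n) w ^+ i = - (n != 0)%:R.
Proof.
case: n => [|n] wn w1; first by rewrite big_nil oppr0.
have := sum_unity_powers K n.+1 w wn; rewrite (negPf w1).
rewrite -(big_mkord xpredT (fun i => w ^+ i)) big_ltn // expr0 => /eqP.
by rewrite addrC addr_eq0 => /eqP.
Qed.

Lemma expr_unity_compl (K : fieldType) (n i : nat) (w : K) :
  w ^+ n = 1 -> (i <= n)%N -> w ^+ (n - i) = w ^- i.
Proof.
move=> wn lin; case: i lin => [|i] lin; first by rewrite subn0 wn expr0 invr1.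
have w0 := unity_neq0 _ _ _ (leq_ltn_trans (leq0n i) lin) wn.
by apply: (mulIf (expf_neq0 i.+1 w0)); rewrite -exprD subnK // wn mulVf ?expf_neq0.
Qed.

Lemma conj_unity_expr (K : numClosedFieldType) (n i : nat) (w : K) :
  (0 < n)%N -> w ^+ n = 1 -> (w ^+ i)^* = w ^- i.
Proof.
move=> n0 wn; have nw : `|w| = 1.
  by apply: (pexpIrn n0); rewrite ?nnegrE // -normrX wn normr1 expr1n.
by rewrite [RHS]invC_norm normrX nw !expr1n invr1 mul1r.
Qed.

(** Fold the triangle along its diagonal: a pair with [i < j] stands for itself and its mirror
    image, hence weight 2, while a diagonal pair is its own mirror. *)
Lemma sum_symmetric_triangle (K : pzRingType) (n : nat) (g : nat -> nat -> K) :
  (forall i j, g i j = g j i) ->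
  \sum_(1 <= i < n) \sum_(1 <= j < n | (i + j < n)%N) g i j =
  \sum_(1 <= i < n) \sum_(i <= j < n - i) (2 - (i == j))%:R * g i j.
Proof.
move=> gC.
have -> : \sum_(1 <= i < n) \sum_(i <= j < n - i) (2 - (i == j))%:R * g i j =
   \sum_(1 <= i < n) \sum_(1 <= j < n | (i <= j < n - i)%N) g i j +
   \sum_(1 <= i < n) \sum_(1 <= j < n | (i < j < n - i)%N) g i j.
  rewrite -big_split; apply: eq_big_nat => i /andP[i0 _].
  rewrite (big_nat_widenl i 1) // (big_nat_widen 1 _ n) ?leq_subr //=.
  rewrite [X in _ = _ + X]big_mkcond [X in _ = X + _]big_mkcond -big_split /=.
  rewrite big_mkcond; apply: eq_bigr => j _ /=.
  have [<-|nij] := eqVneq i j; rewrite ?leqnn ?ltnn ?addr0 ?mul1r //=.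
  rewrite !ltn_neqAle nij /= subn0.
  by case: ifP => _; rewrite ?addr0 // mulr2n mulrDl mul1r.
rewrite [X in _ = _ + X](exchange_big_dep_nat xpredT) //= -big_split.
apply: eq_big_nat => i /andP[i1 iN] /=.
rewrite [X in _ = X + _]big_mkcond [X in _ = _ + X]big_mkcond -big_split.
rewrite big_mkcond; apply: eq_big_nat => j /andP[j1 jN] /=.
rewrite (gC j i).
have [lij|lji] := leqP i j; rewrite /= ?add0r ?addr0.
  by have -> : (i + j < n)%N = (j < n - i)%N by lia.
by have -> : (i + j < n)%N = (i < n - j)%N by lia.
Qed.

(** * Jacobi sums over a finite field *)

Section CharacterCount.

Variables (K : numClosedFieldType) (F : finFieldType) (T : finType).
(* In the application T is Z/q, u b = psi b and v b = psi (1 - b). *)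
Variables (n : nat) (chi : F -> K) (B : {set T}) (u v : T -> K).
Hypothesis n_gt0 : (0 < n)%N.
Hypothesis chi0 : chi 0 = 0.
Hypothesis chiM : {morph chi : x y / x * y}.
Hypothesis chi_unity : forall x, x != 0 -> chi x ^+ n = 1.
Hypothesis chi_nontriv :
  forall i, (0 < i < n)%N -> exists2 g, g != 0 & chi g ^+ i != 1.

Let J i j := \sum_x chi x ^+ i * chi (1 - x) ^+ j.
(* J' omits c = 0, 1, so it differs from J when an exponent is 0 (0 ^+ 0 = 1). *)
Let J' i j := \sum_(x | (x != 0) && (1 - x != 0)) chi x ^+ i * chi (1 - x) ^+ j.

Lemma chi_one : chi 1 = 1.
Proof.
have h := unity_neq0 _ n _ n_gt0 (chi_unity 1 (oner_neq0 _)).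
by apply: (mulfI h); rewrite -chiM !mulr1.
Qed.

(** Multiplication by [g] permutes [F] and scales the sum by [chi g ^+ i], which differs from 1. *)
Lemma sum_chi_expr i : (0 < i < n)%N -> \sum_x chi x ^+ i = 0.
Proof.
move=> i_n; have [g g0 gi] := chi_nontriv i i_n.
have /eqP : \sum_x chi x ^+ i = chi g ^+ i * \sum_x chi x ^+ i.
  rewrite {1}(reindex (fun x => g * x)) /=.
    by rewrite mulr_sumr; apply: eq_bigr => x _; rewrite chiM exprMn.
  by exists (fun x => g^-1 * x) => x _; [rewrite mulKf|rewrite mulVKf].
rewrite -subr_eq0 -{1}[\sum_x _]mul1r -mulrBl mulf_eq0 subr_eq0 eq_sym.
by rewrite (negPf gi) => /eqP.
Qed.

Lemma jacobi_restrict i j : (0 < i)%N -> (0 < j)%N -> J' i j = J i j.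
Proof.
move=> i0 j0; rewrite /J (bigID (fun x => (x != 0) && (1 - x != 0))) /=.
rewrite [X in _ = _ + X]big1 ?addr0 // => x.
rewrite negb_and !negbK => /orP[] /eqP ->.
  by rewrite chi0 expr0n eqn0Ngt i0 mul0r.
by rewrite chi0 [0 ^+ j]expr0n eqn0Ngt j0 mulr0.
Qed.

Lemma jacobi_sym i j : J i j = J j i.
Proof.
rewrite /J (reindex (fun x => 1 - x)) /=.
  by apply: eq_bigr => x _; rewrite mulrC; congr (chi _ ^+ _ * _); ring.
by exists (fun x => 1 - x) => x _ /=; ring.
Qed.

Lemma jacobi00 : J' 0 0 = #|F|%:R - 2.
Proof.
rewrite /J'; under eq_bigr do rewrite !expr0 mul1r.
rewrite sumr_const; have -> : #|F| = (2 + #|[pred x : F | (x != 0) && (1 - x != 0)]%R|)%N.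
  rewrite -cardsT (cardsD1 0) (cardsD1 1) !inE oner_neq0 /= addnA; congr (_ + _)%N.
  by rewrite cardsE; apply: eq_card => x; rewrite !inE [LHS]unfold_in !inE andbT subr_eq0 [1 == x]eq_sym andbC.
by rewrite natrD addrC addKr.
Qed.

(** The full sum of the nontrivial power is 0; omitting [x = 0] removes [chi 1 ^+ j = 1], and
    omitting [x = 1] removes 0. *)
Lemma jacobi0r j : (0 < j < n)%N -> J' 0 j = -1.
Proof.
move=> jn; have := sum_chi_expr j jn.
rewrite (reindex (fun x => 1 - x)) /=; last by exists (fun x => 1 - x) => x _ /=; ring.
rewrite (bigD1 0) //= subr0 chi_one expr1n => /eqP.
rewrite addrC addr_eq0 => /eqP <-; rewrite /J' [RHS](bigID (fun x => 1 - x != 0)) /=.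
rewrite [X in _ = _ + X]big1 ?addr0; last first.
  move=> x /andP[_]; rewrite negbK => /eqP ->.
  by rewrite chi0 expr0n; case: j jn.
by apply: eq_bigr => x _; rewrite expr0 mul1r.
Qed.

Lemma jacobi_restrict_sym i j : J' i j = J' j i.
Proof.
rewrite /J' (reindex (fun x => 1 - x)) /=.
  apply: eq_big => [x|x _]; first by rewrite subKr andbC.
  by rewrite mulrC; congr (chi _ ^+ _ * _); ring.
by exists (fun x => 1 - x) => x _ /=; ring.
Qed.

(* Substitute y = x / (1 - x), which misses only the values 0 and -1. *)
Lemma jacobi_compl i : (0 < i < n)%N -> J' i (n - i) = - chi (-1) ^+ i.
Proof.
move=> i_n; have := sum_chi_expr i i_n; have /andP[i0 lin] := i_n.
rewrite (bigD1 (-1)) //= => /eqP; rewrite addr_eq0 => /eqP ->; rewrite opprK.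
rewrite [RHS](bigD1 0) /=; last by rewrite eq_sym oppr_eq0 oner_neq0.
rewrite chi0 expr0n eqn0Ngt i0 add0r.
rewrite [RHS](reindex_onto (fun x => x / (1 - x)) (fun y => y / (1 + y))) /=.
  rewrite /J'; apply: eq_big => [x|x /andP[x0 x1]].
    have [x1|x1] /= := eqVneq (1 - x) 0.
      by rewrite x1 invr0 mulr0 eqxx !andbF.
    have e : 1 + x / (1 - x) = (1 - x)^-1 by field.
    rewrite e invrK divfK // eqxx andbT mulf_eq0 invr_eq0 (negPf x1) orbF andbT.
    by rewrite -[x / _ == -1]addr_eq0 addrC e invr_eq0 x1.
  (* Since [chi (1 - x) ^+ (n - i)] is the inverse of [chi (1 - x) ^+ i], the product is the [i]-th
     power of [chi] at the quotient. *)
  rewrite expr_unity_compl ?chi_unity // ?(ltnW lin) // -exprVn -exprMn.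
  have cx := unity_neq0 _ n _ n_gt0 (chi_unity _ x1).
  by congr (_ ^+ i); apply: (mulIf cx); rewrite divfK // -chiM divfK.
move=> y /andP[y1 _]; have y1' : 1 + y != 0 by rewrite addrC addr_eq0.
by field; rewrite y1' /=; apply: contraTneq isT => /eqP; rewrite (_ : _ - _ = 1) ?oner_eq0 //; ring.
Qed.

Hypothesis u_unity : {in B, forall b, u b ^+ n = 1}.
Hypothesis v_unity : {in B, forall b, v b ^+ n = 1}.
(** These three conditions keep the bases of the geometric sums for [j = 0], [i = 0] and [i + j = n]
    away from 1. *)
Hypothesis u_neq1 : {in B, forall b, u b != 1}.
Hypothesis v_neq1 : {in B, forall b, v b != 1}.
Hypothesis uv_neq : {in B, forall b, chi (-1) * v b != u b}.

(** * Counting by orthogonality and pairing conjugate terms *)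

Let c i j := \sum_(b in B) u b ^- i * v b ^- j.

(** Orthogonality: the summands are the powers of the [n]-th root of unity [w / z], which is 1
    exactly when [w = z]. *)
Lemma ind_eq_unity (w z : K) : w ^+ n = 1 -> z ^+ n = 1 ->
  n%:R * (w == z)%:R = \sum_(i < n) w ^+ i * z ^- i.
Proof.
move=> wn zn; have z0 := unity_neq0 _ n _ n_gt0 zn.
under eq_bigr do rewrite -exprVn -exprMn.
rewrite sum_unity_powers; last by rewrite exprMn wn exprVn zn invr1 mulr1.
have -> : (w / z == 1) = (w == z).
  by rewrite -[1](divff z0) (inj_eq (mulIf _)) // invr_eq0.
by case: eqP; rewrite (mulr1, mulr0).
Qed.

(** The count is a sum of products of two indicators. Each absorbs one factor [n] when expanded by
    orthogonality; summing over [x] first then produces [J'], and over [b] the coefficient [c]. *)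
Lemma card_char_fibres :
  n%:R ^+ 2 * #|[set xb : F * T | [&& xb.1 != 0, 1 - xb.1 != 0, xb.2 \in B,
     chi xb.1 == u xb.2 & chi (1 - xb.1) == v xb.2]]|%:R =
  \sum_(i < n) \sum_(j < n) c i j * J' i j.
Proof.
rewrite -sum1_card natr_sum.
have -> : \sum_(xb in [set xb : F * T | [&& xb.1 != 0, 1 - xb.1 != 0, xb.2 \in B,
     chi xb.1 == u xb.2 & chi (1 - xb.1) == v xb.2]]) 1%:R =
   \sum_(x | (x != 0) && (1 - x != 0)) \sum_(b in B)
     (chi x == u b)%:R * (chi (1 - x) == v b)%:R :> K.
  rewrite pair_big /= big_mkcond [RHS]big_mkcond /=; apply: eq_bigr => -[x b] _ /=.
  rewrite inE /=; case: (x == 0); case: (1 - x == 0); case: (b \in B) => //=;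
  by case: (chi x == _); case: (chi _ == _); rewrite ?mulr0 ?mul0r ?mulr1.
rewrite mulr_sumr.
transitivity (\sum_(x | (x != 0) && (1 - x != 0)) \sum_(b in B)
   \sum_(i < n) \sum_(j < n)
     (u b ^- i * v b ^- j) * (chi x ^+ i * chi (1 - x) ^+ j)).
  apply: eq_bigr => x /andP[x0 x1]; rewrite mulr_sumr; apply: eq_bigr => b bB.
  transitivity ((n%:R * (chi x == u b)%:R) * (n%:R * (chi (1 - x) == v b)%:R) : K).
    by ring.
  rewrite !ind_eq_unity ?chi_unity ?u_unity ?v_unity // mulr_suml.
  apply: eq_bigr => i _; rewrite mulr_sumr; apply: eq_bigr => j _; ring.
under eq_bigr => x _ do rewrite exchange_big.
rewrite exchange_big; apply: eq_bigr => i _ /=.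
under eq_bigr => x _ do rewrite exchange_big.
rewrite exchange_big; apply: eq_bigr => j _ /=.
rewrite /c /J' mulr_suml exchange_big; apply: eq_bigr => b _ /=.
by rewrite mulr_sumr.
Qed.

(** The coefficient of [#|B|] collects [#|F| - 2] from the corner [i = j = 0] and 1 from each of the
    two edges and the antidiagonal. *)
Lemma sum_jacobi_split :
  \sum_(i < n) \sum_(j < n) c i j * J' i j =
  (#|F|.+1)%:R * #|B|%:R +
  (\sum_(1 <= i < n) \sum_(1 <= j < n | (i + j < n)%N) c i j * J i j +
   \sum_(1 <= i < n) \sum_(1 <= j < n | (n < i + j)%N) c i j * J i j).
Proof.
have n0 : (n != 0)%N by rewrite -lt0n.
under eq_bigr => i _ do rewrite -(big_mkord xpredT (fun j => c i j * J' i j)).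
rewrite -(big_mkord xpredT (fun i => \sum_(0 <= j < n) c i j * J' i j)).
rewrite big_ltn // [X in X + _]big_ltn //.
under [X in _ + X]eq_bigr => i _ do rewrite big_ltn //.
rewrite big_split /=.
have E00 : c 0 0 * J' 0 0 = #|B|%:R * (#|F|%:R - 2).
  rewrite jacobi00 /c; congr (_ * _).
  by under eq_bigr do rewrite !expr0 invr1 mul1r; rewrite sumr_const.
have E0j : \sum_(1 <= j < n) c 0 j * J' 0 j = #|B|%:R.
  under eq_big_nat => j jn do rewrite jacobi0r // mulrN1.
  rewrite sumrN /c exchange_big /= -sumrN.
  under eq_bigr => b bB.
    under eq_bigr do rewrite expr0 invr1 mul1r -exprVn.
    rewrite sum_unity_powers_pos ?exprVn ?v_unity ?invr1 ?invr_eq1 ?v_neq1 //.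
    rewrite n0 opprK; over.
  by rewrite sumr_const.
have Ei0 : \sum_(1 <= i < n) c i 0 * J' i 0 = #|B|%:R.
  under eq_big_nat => i i_n do rewrite jacobi_restrict_sym jacobi0r // mulrN1.
  rewrite sumrN /c exchange_big /= -sumrN.
  under eq_bigr => b bB.
    under eq_bigr do rewrite expr0 invr1 mulr1 -exprVn.
    rewrite sum_unity_powers_pos ?exprVn ?u_unity ?invr1 ?invr_eq1 ?u_neq1 //.
    rewrite n0 opprK; over.
  by rewrite sumr_const.
(* For fixed [b] the terms are, up to sign, the powers of [chi (-1) * v b / u b], whose sum over
   positive exponents is -1 by [uv_neq]. *)
have Ecompl : \sum_(1 <= i < n) c i (n - i) * J' i (n - i) = #|B|%:R.
  under eq_big_nat => i i_n do rewrite jacobi_compl // mulrN.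
  rewrite sumrN /c; under eq_bigr do rewrite mulr_suml.
  rewrite exchange_big /= -sumrN.
  under eq_bigr => b bB.
    under eq_big_nat => i /andP[_ /ltnW lin] do
      rewrite expr_unity_compl ?v_unity // invrK -exprVn -!exprMn.
    have u0 := unity_neq0 _ n _ n_gt0 (u_unity _ bB).
    rewrite sum_unity_powers_pos.
    - rewrite n0 opprK; over.
    - rewrite !exprMn exprVn u_unity // v_unity // invr1 !mul1r.
      by rewrite chi_unity // oppr_eq0 oner_neq0.
    - have := uv_neq _ bB; apply: contraNneq => e.
      by rewrite -[eqbRHS]mulr1 -e mulrA mulVKf // mulrC.
  by rewrite sumr_const.
have -> : \sum_(1 <= i < n) \sum_(1 <= j < n) c i j * J' i j = #|B|%:R +
  (\sum_(1 <= i < n) \sum_(1 <= j < n | (i + j < n)%N) c i j * J i j +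
   \sum_(1 <= i < n) \sum_(1 <= j < n | (n < i + j)%N) c i j * J i j).
  rewrite -Ecompl -!big_split /=; apply: eq_big_nat => i /andP[i0 lin].
  rewrite (bigD1_seq (n - i)%N) ?iota_uniq ?mem_index_iota //=; last by lia.
  congr (_ + _); rewrite [X in _ = X + _]big_mkcond [X in _ = _ + X]big_mkcond.
  rewrite -big_split big_mkcond; apply: eq_big_nat => j /andP[j0 ljn] /=.
  rewrite jacobi_restrict //; case: (ltngtP (i + j) n) => h.
  - by rewrite ifT ?addr0 //; lia.
  - by rewrite ifT ?add0r //; lia.
  - by rewrite ifF ?addr0 //; lia.
rewrite E00 E0j Ei0 -[#|F|.+1]addn1 natrD; ring.
Qed.

Lemma jacobi_coef_conj i j : (0 < i < n)%N -> (0 < j < n)%N ->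
  c (n - i) (n - j) * J (n - i) (n - j) = (c i j * J i j)^*.
Proof.
move=> /andP[i0 lin] /andP[j0 ljn]; rewrite rmorphM; congr (_ * _).
  rewrite /c rmorph_sum /=; apply: eq_bigr => b bB.
  rewrite !expr_unity_compl ?u_unity ?v_unity ?(ltnW lin) ?(ltnW ljn) // !invrK.
  by rewrite rmorphM /= !fmorphV /= !(conj_unity_expr _ n) ?u_unity ?v_unity // !invrK.
(* In [J'] both arguments of [chi] are nonzero, so its values are roots of unity and conjugation
   inverts them. *)
rewrite -!jacobi_restrict ?subn_gt0 // /J' rmorph_sum.
apply: eq_bigr => x /andP[x0 x1] /=.
rewrite !expr_unity_compl ?chi_unity ?(ltnW lin) ?(ltnW ljn) //.
by rewrite rmorphM /= !(conj_unity_expr _ n) ?chi_unity.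
Qed.

(** Reversing both ranges sends [(i, j)] to [(n - i, n - j)] and so exchanges the two triangles. *)
Lemma sum_jacobi_upper :
  \sum_(1 <= i < n) \sum_(1 <= j < n | (n < i + j)%N) c i j * J i j =
  \sum_(1 <= i < n) \sum_(1 <= j < n | (i + j < n)%N) (c i j * J i j)^*.
Proof.
rewrite big_nat_rev; apply: eq_big_nat => i /andP[i0 lin].
rewrite big_nat_rev big_nat_cond [RHS]big_nat_cond.
apply: eq_big => [j|j /andP[/andP[j0 ljn] _]] /=; first by lia.
by rewrite -jacobi_coef_conj ?i0 ?j0.
Qed.

Hypothesis c_sym : forall i j, c i j = c j i.

Theorem card_char_fibres_Re :
  n%:R ^+ 2 * #|[set xb : F * T | [&& xb.1 != 0, 1 - xb.1 != 0, xb.2 \in B,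
     chi xb.1 == u xb.2 & chi (1 - xb.1) == v xb.2]]|%:R =
  (#|F|.+1)%:R * #|B|%:R +
  \sum_(1 <= i < n) \sum_(i <= j < n - i)
     (2 * (2 - (i == j)))%:R * 'Re (c i j * J i j).
Proof.
rewrite card_char_fibres sum_jacobi_split sum_jacobi_upper; congr (_ + _).
rewrite -big_split /=; under eq_bigr do rewrite -big_split /=.
rewrite (@sum_symmetric_triangle _ _ (fun i j => c i j * J i j + (c i j * J i j)^*)).
  apply: eq_bigr => i _; apply: eq_bigr => j _.
  rewrite [(2 * (2 - _))%N]mulnC natrM -mulrA; congr (_ * _).
  by rewrite ReE [RHS]mulrC divfK ?pnatr_eq0.
by move=> i j; rewrite c_sym jacobi_sym.
Qed.

End CharacterCount.

(** * The root of unity [zeta n] and the values of characters given by [pick] *)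

Lemma cos_sin_natmul (R : realType) (x : R) (k : nat) :
  ((cos x +i* sin x)%C : complex R) ^+ k = (cos (x *+ k) +i* sin (x *+ k))%C.
Proof.
elim: k => [|k IH]; first by rewrite !mulr0n trigo.cos0 trigo.sin0.
rewrite exprS IH mulrS trigo.cosD trigo.sinD; apply/eqP; rewrite eq_complex /=.
by rewrite eqxx /= [sin x * _]mulrC [X in _ == X]addrC [cos _ * sin x]mulrC eqxx.
Qed.

Lemma zeta_primitive (n : nat) : (0 < n)%N -> n.-primitive_root (zeta n).
Proof.
move=> n0.
have nR : 0 < (n%:R : Rdefinitions.R) by rewrite ltr0n.
have zn : zeta n ^+ n = 1.
  rewrite /zeta cos_sin_natmul -[_ *+ n]mulr_natr divfK ?gt_eqF // mulrC mulr_natr.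
  by rewrite cos2pi sin2pi.
have [m zm mn] := prim_order_exists n0 zn.
suff e : n = m by rewrite {1}e.
have m0 := prim_order_gt0 zm.
apply/eqP; rewrite eqn_leq (dvdn_leq n0 mn) andbT leqNgt; apply/negP => mltn.
have := prim_expr_order zm; rewrite /zeta cos_sin_natmul => /eqP.
rewrite eq_complex /= => /andP[/eqP + _].
have -> : (2 * pi / n%:R) *+ m = (pi * (m%:R / n%:R)) *+ 2 :> Rdefinitions.R.
  by rewrite -[RHS]mulr_natr -[LHS]mulr_natr; ring.
rewrite cos_mulr2n.
(* If the order [m] were less than [n], then [y = pi * m / n] would lie strictly between 0 and pi
   with [cos (2 y) = 1], forcing [sin y = 0]. *)
set y := pi * _ => cosy.
have : 0 < sin y.
  apply: sin_gt0_pi; rewrite /y mulr_gt0 ?pi_gt0 ?divr_gt0 ?ltr0n //=.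
  by rewrite gtr_pMr ?pi_gt0 // ltr_pdivrMr // mul1r ltr_nat.
have := cos2Dsin2 y; nra.
Qed.

(** The choice made by [pick] is harmless: exponents giving the same power of [g] agree modulo [m],
    hence give the same power of [z]. *)
Lemma pick_expr (R : nzRingType) (m k : nat) (g : R) (z : C) :
  m.-primitive_root g -> z ^+ m = 1 ->
  (if [pick j : 'I_m | g ^+ j == g ^+ k] is Some j then z ^+ j else 0) = z ^+ k.
Proof.
move=> gm zm; case: pickP => [j|/(_ (Ordinal (ltn_pmod k (prim_order_gt0 gm))))].
  by rewrite (eq_prim_root_expr gm) => /eqP e; rewrite -(expr_mod j zm) e expr_mod.
by rewrite /= (prim_expr_mod gm) eqxx.
Qed.

(** * Reduction of residues and the Chinese remainder theorem *)

Section Reduction.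

Variables (N : nat) (R : nzRingType).
Hypothesis N_gt1 : (1 < N)%N.
Hypothesis N_R : N%:R = 0 :> R.

(** This makes the cast of representatives into [R] a ring morphism on ['Z_N]; it serves for
    [R = 'F_p] and [R = 'Z_q] with [N = p * q]. *)
Lemma natr_modn k : (k %% N)%:R = k%:R :> R.
Proof. by rewrite {2}(divn_eq k N) natrD natrM N_R mulr0 add0r. Qed.

Lemma Zp_natrD (x y : 'Z_N) : (val (x + y))%:R = (val x)%:R + (val y)%:R :> R.
Proof. by rewrite /= [in X in (_ %% X)%N]Zp_cast // natr_modn natrD. Qed.

Lemma Zp_natrM (x y : 'Z_N) : (val (x * y))%:R = (val x)%:R * (val y)%:R :> R.
Proof. by rewrite /= [in X in (_ %% X)%N]Zp_cast // natr_modn natrM. Qed.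

Lemma Zp_natr1 : (val (1 : 'Z_N))%:R = 1 :> R.
Proof. by rewrite /= [in X in (_ %% X)%N]Zp_cast // natr_modn. Qed.

Lemma Zp_natrN (x : 'Z_N) : (val (- x))%:R = - (val x)%:R :> R.
Proof.
by apply/eqP; rewrite -addr_eq0 -Zp_natrD addNr.
Qed.

Lemma Zp_natrX (x : 'Z_N) k : (val (x ^+ k))%:R = (val x)%:R ^+ k :> R.
Proof. by elim: k => [|k IH]; rewrite ?Zp_natr1 // !exprS Zp_natrM IH. Qed.

End Reduction.

Lemma Zp_natr_inj (p q : nat) (x y : 'Z_(p * q)) :
  prime p -> (1 < q)%N -> coprime p q ->
  (val x)%:R = (val y)%:R :> 'F_p -> (val x)%:R = (val y)%:R :> 'Z_q -> x = y.
Proof.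
move=> pp q1 cpq /(congr1 val) ep /(congr1 val) eq; apply: val_inj.
move: ep eq; rewrite /= val_Fp_nat // val_Fp_nat // !val_Zp_nat // => ep eq.
have pq1 : (1 < p * q)%N by have := prime_gt1 pp; nia.
have := chinese_remainder cpq x y; rewrite ep eq !eqxx /=.
by rewrite !modn_small -?[X in (_ < X)%N](Zp_cast pq1) // => /eqP.
Qed.

(** * The count for the set of powers of [a] *)

Theorem mainTheorem9 (p q : nat) (a : 'Z_(p * q)) (n : nat) :
  odd q -> (1 < q)%N -> prime p -> (q < p)%N ->
  a \is a GRing.unit ->
  a ^+ (p.-1./2) = -1 ->
  (* alpha := a mod p generates F_p^* *)
  (forall x : 'F_p, x != 0 ->
     exists j : nat, ((val a)%:R : 'F_p) ^+ j = x) ->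
  (* n is the multiplicative order of beta := a mod q *)
  (0 < n)%N -> ((val a)%:R : 'Z_q) ^+ n = 1 ->
  (forall m, (0 < m < n)%N -> ((val a)%:R : 'Z_q) ^+ m != 1) ->
  let alpha : 'F_p := (val a)%:R in
  let beta : 'Z_q := (val a)%:R in
  let G := cyc n beta in
  let B := [set b in G | b - 1 \in G] in
  let c (i j : nat) : C :=
    \sum_(b in B) (psi n beta b) ^- i * (psi n beta (1 - b)) ^- j in
  let X := chi n alpha in
  let S := Spq a in
  (#|S :&: shift1 S|)%:R =
    (n%:R ^+ 2)^-1 *
      ((p.+1)%:R * (#|B|)%:R +
       \sum_(1 <= i < n) \sum_(i <= j < n - i)
          (2 * (2 - (i == j)))%:R *
            'Re (c i j * jacobi (charpow X i) (charpow X j))) :> C.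
Proof.
move=> q_odd q1 pp qp _ ah alpha_gen n0 bn bmin alpha beta G B c X S.
have p1 := prime_gt1 pp.
have pq1 : (1 < p * q)%N by nia.
have cpq : coprime p q by rewrite prime_coprime // gtnNdvd // ltnW.
have Fpq : (p * q)%:R = 0 :> 'F_p by rewrite natrM pchar_Fp_0 // mul0r.
have Zpq : (p * q)%:R = 0 :> 'Z_q by rewrite natrM pchar_Zp // mulr0.
have alphaX k : (val (a ^+ k))%:R = alpha ^+ k by exact: Zp_natrX.
have betaX k : (val (a ^+ k))%:R = beta ^+ k by exact: Zp_natrX.
set h := p.-1./2 in ah.
have hh : (h + h = p.-1)%N.
  (* The case [p = 2] contradicts [1 < q < p]. *)
  have [p2|p_odd] := even_prime pp; first by lia.
  by rewrite /h addnn halfK; case: (p) p_odd p1 => //= k /negPf ->; rewrite subn0.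
have alpha_h : alpha ^+ h = -1 by rewrite -alphaX ah Zp_natrN // Zp_natr1.
have beta_h : beta ^+ h = -1 by rewrite -betaX ah Zp_natrN // Zp_natr1.
have a1 : a ^+ p.-1 = 1 by rewrite -hh exprD ah mulrNN mulr1.
have p1_gt0 : (0 < p.-1)%N by lia.
have alpha1 : alpha ^+ p.-1 = 1 by rewrite -alphaX a1 Zp_natr1.
have alpha_prim : p.-1.-primitive_root alpha.
  have [m am mdvd] := prim_order_exists p1_gt0 alpha1.
  suff em : m = p.-1 by rewrite -{1}em.
  apply/eqP; rewrite eqn_leq dvdn_leq //=.
  (* The powers of [alpha] cover all [p - 1] nonzero residues, so the order [m] is at least
     [p - 1]. *)
  have sub : [set~ (0 : 'F_p)] \subset [set alpha ^+ (i : 'I_m) | i in 'I_m].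
    apply/subsetP => x; rewrite !inE => /alpha_gen[j <-].
    apply/imsetP; exists (Ordinal (ltn_pmod j (prim_order_gt0 am))) => //=.
    by rewrite prim_expr_mod.
  have := subset_leq_card sub; rewrite cardsC1 card_Fp // => /leq_trans; apply.
  by rewrite -[X in (_ <= X)%N]card_ord leq_imset_card.
have beta_prim : n.-primitive_root beta.
  have [m bm md] := prim_order_exists n0 bn.
  suff em : m = n by rewrite -{1}em.
  have := dvdn_leq n0 md; rewrite leq_eqVlt => /orP[/eqP//|mn].
  have := bmin m; rewrite mn (prim_order_gt0 bm) => /(_ isT).
  by rewrite -/beta (prim_expr_order bm) eqxx.
have n_dvd : (n %| p.-1)%N.
  by rewrite (prim_order_dvd beta_prim) -betaX a1 Zp_natr1.
have zprim := zeta_primitive n n0; have zn := prim_expr_order zprim.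
have zp1 : zeta n ^+ p.-1 = 1 by apply/eqP; rewrite -(prim_order_dvd zprim).
have chiX k : X (alpha ^+ k) = zeta n ^+ k by rewrite /X /chi pick_expr.
have psiX k : psi n beta (beta ^+ k) = zeta n ^+ k by rewrite /psi pick_expr.
have GP x : reflect (exists k, x = beta ^+ k) (x \in G).
  apply: (iffP imsetP) => [[k _ ->]|[k ->]]; first by exists k.
  by exists (Ordinal (ltn_pmod k n0)) => //=; rewrite (prim_expr_mod beta_prim).
have GN x : x \in G -> - x \in G.
  move=> /GP[k ->]; apply/GP; exists (h + k)%N.
  by rewrite exprD beta_h mulN1r.
(* This excludes 0 and 1 from [B], which gives [u_neq1] and [v_neq1] below. *)
have G0 : 0 \notin G.
  apply/GP => -[k /(congr1 (fun x => x ^+ n))].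
  rewrite exprAC bn expr1n expr0n eqn0Ngt n0 => /eqP.
  by rewrite eq_sym oner_eq0.
have psi_inj : {in G &, injective (psi n beta)}.
  move=> _ _ /GP[k ->] /GP[l ->]; rewrite !psiX => /eqP.
  by rewrite (eq_prim_root_expr zprim) -(eq_prim_root_expr beta_prim) => /eqP.
have psi_unity x : x \in G -> psi n beta x ^+ n = 1.
  by move=> /GP[k ->]; rewrite psiX exprAC zn expr1n.
have G1 : 1 \in G by apply/GP; exists 0%N.
have psi1 : psi n beta 1 = 1 by rewrite -(expr0 beta) psiX.
have alphaP x : x != 0 -> exists k, x = alpha ^+ k.
  by move=> /alpha_gen[k <-]; exists k.
have alpha0 k : alpha ^+ k != 0.
  by rewrite expf_neq0 //; exact: unity_neq0 p1_gt0 alpha1.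
have X0 : X 0 = 0.
  by rewrite /X /chi; case: pickP => // j; rewrite (negPf (alpha0 _)).
have XM : {morph X : x y / x * y}.
  move=> x y; have [->|/alphaP[k ->]] := eqVneq x 0; first by rewrite !mul0r X0 mul0r.
  have [->|/alphaP[l ->]] := eqVneq y 0; first by rewrite !mulr0 X0 mulr0.
  by rewrite -exprD !chiX exprD.
have X_unity x : x != 0 -> X x ^+ n = 1.
  by move=> /alphaP[k ->]; rewrite chiX exprAC zn expr1n.
have X_nontriv i : (0 < i < n)%N -> exists2 g, g != 0 & X g ^+ i != 1.
  move=> /andP[i0 lin]; exists (alpha ^+ 1); first exact: alpha0.
  by rewrite chiX expr1 -(prim_order_dvd zprim) gtnNdvd.
have XN1 : X (-1) = zeta n ^+ h by rewrite -alpha_h chiX.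
(* The same exponent [h] gives -1 as a power of [alpha] and of [beta], so both characters take the
   value [zeta n ^+ h] there. *)
have psiN x : x \in G -> psi n beta (- x) = X (-1) * psi n beta x.
  move=> /GP[k ->]; have -> : - beta ^+ k = beta ^+ (h + k).
    by rewrite exprD beta_h mulN1r.
  by rewrite !psiX exprD XN1.
have XN x : X (- x) = X (-1) * X x by rewrite -XM mulN1r.
have XN1N1 : X (-1) * X (-1) = 1 by rewrite XN1 -exprD hh.
have BP b : b \in B -> [/\ b \in G, b - 1 \in G & 1 - b \in G].
  by rewrite inE => /andP[bG b1]; rewrite bG b1 -opprB GN.
have u_unity : {in B, forall b, psi n beta b ^+ n = 1}.
  by move=> b /BP[bG _ _]; exact: psi_unity.
have v_unity : {in B, forall b, psi n beta (1 - b) ^+ n = 1}.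
  by move=> b /BP[_ _ bG]; exact: psi_unity.
have u_neq1 : {in B, forall b, psi n beta b != 1}.
  move=> b /BP[bG + _]; apply: contraTneq; rewrite -psi1.
  by move=> /(psi_inj _ _ bG G1) ->; rewrite subrr.
have v_neq1 : {in B, forall b, psi n beta (1 - b) != 1}.
  move=> b /BP[+ _ bG]; apply: contraTneq; rewrite -psi1.
  by move=> /(psi_inj _ _ bG G1)/eqP; rewrite subr_eq addrC -subr_eq subrr => /eqP <-.
(* The left side is [psi] at [b - 1]; equality would force [b - 1 = b] by injectivity. *)
have uv_neq : {in B, forall b, X (-1) * psi n beta (1 - b) != psi n beta b}.
  move=> b /BP[bG b1G b1G']; rewrite -psiN // opprB.
  apply/eqP => /(psi_inj _ _ b1G bG)/eqP; rewrite subr_eq addrC -subr_eq subrr.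
  by rewrite eq_sym oner_eq0.
have B_compl b : b \in B -> 1 - b \in B.
  by move=> /BP[bG _ b1G]; rewrite inE b1G addrAC subrr add0r GN.
have c_sym i j : c i j = c j i.
  rewrite /c (reindex (fun b => 1 - b)) /=; last first.
    by exists (fun b => 1 - b) => b _ /=; rewrite subKr.
  apply: eq_big => [b|b _]; last by rewrite subKr mulrC.
  by apply/idP/idP => /B_compl; rewrite ?subKr.
(* For [0 < k < n] the power is nontrivial, so the convention at 0 agrees with [0 ^+ k = 0]. *)
have J_eq i j : (0 < i < n)%N -> (0 < j < n)%N ->
    jacobi (charpow X i) (charpow X j) = \sum_x X x ^+ i * X (1 - x) ^+ j.
  have E k : (0 < k < n)%N -> charpow X k =1 (fun x => X x ^+ k).
    move=> kn x; rewrite /charpow; case: eqP => // ->.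
    rewrite X0 expr0n; have /andP[k0 _] := kn; rewrite eqn0Ngt k0.
    case: forallP => // triv; have [g g0] := X_nontriv k kn.
    by have := triv g; rewrite g0 /= => ->.
  by move=> i_n jn; apply: eq_bigr => x _; rewrite !E.
have := card_char_fibres_Re _ _ _ _ _ _ _ _ n0 X0 XM X_unity X_nontriv
  u_unity v_unity u_neq1 v_neq1 uv_neq c_sym.
set A := [set xb | _].
have -> : #|A| = #|S :&: shift1 S|.
  pose f (s : 'Z_(p * q)) : 'F_p * 'Z_q := ((val s)%:R, (val s)%:R).
  have f_inj : injective f by move=> s t [] /Zp_natr_inj; apply.
  have fD s t : f (s + t) = f s + f t by rewrite /f !Zp_natrD.
  have f1 : f 1 = (1, 1) by rewrite /f !Zp_natr1.
  have fX k : f (a ^+ k) = (alpha ^+ k, beta ^+ k) by rewrite /f alphaX betaX.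
  have SP s : reflect (exists k, s = a ^+ k) (s \in S).
    apply: (iffP imsetP) => [[k _ ->]|[k ->]]; first by exists k.
    by exists (Ordinal (ltn_pmod k p1_gt0)) => //=; rewrite expr_mod.
  (* Equal character values make the exponents of [alpha] and [beta] congruent modulo [n], so the
     exponent of [alpha] serves for both components. *)
  have lift x b : x != 0 -> b \in G -> X x = psi n beta b ->
      exists k, (x, b) = f (a ^+ k).
    move=> /alphaP[k ->] /GP[l ->]; rewrite chiX psiX => /eqP.
    rewrite (eq_prim_root_expr zprim) -(eq_prim_root_expr beta_prim) => /eqP e.
    by exists k; rewrite fX e.
  rewrite -(card_imset _ f_inj); apply: eq_card => -[x b].
  rewrite inE /=; apply/idP/imsetP => [/and5P[x0 x1 /BP[bG b1G b1G'] /eqP e /eqP e1]|].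
    (* Both [(x, b)] and [(x - 1, b - 1)] lift to powers of [a]; the sign change in the second
       multiplies both characters by [X (-1)]. *)
    have [k ek] := lift x b x0 bG e.
    have x1' : x - 1 != 0 by rewrite -oppr_eq0 opprB.
    have e1' : X (x - 1) = psi n beta (b - 1).
      by rewrite -[x - 1]opprB -[b - 1]opprB XN e1 psiN.
    have [l el] := lift (x - 1) (b - 1) x1' b1G e1'.
    exists (a ^+ k) => //; rewrite inE; apply/andP; split; first by apply/SP; exists k.
    apply/imsetP; exists (a ^+ l); first by apply/SP; exists l.
    by apply: f_inj; rewrite fD f1 -ek -el; congr pair; rewrite /= subrK.
  (* Conversely [a ^+ k = a ^+ l + 1] gives [1 - a ^+ k = a ^+ (h + l)] in both components, with
     matching exponents. *)
  move=> [s]; rewrite inE => /andP[/SP[k ->] /imsetP[_ /SP[l ->] e]].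
  rewrite fX => -[-> ->].
  have := fX k; rewrite e fD f1 fX => -[ea eb].
  have xE : 1 - alpha ^+ k = alpha ^+ (h + l).
    by rewrite -ea opprD addrCA subrr addr0 exprD alpha_h mulN1r.
  have bE : 1 - beta ^+ k = beta ^+ (h + l).
    by rewrite -eb opprD addrCA subrr addr0 exprD beta_h mulN1r.
  rewrite xE bE !alpha0 !chiX !psiX !eqxx inE /= !andbT.
  by apply/andP; split; apply/GP; [exists k|exists l; rewrite -eb addrK].
rewrite card_Fp // => E.
have n2 : (n%:R : C) ^+ 2 != 0 by rewrite expf_neq0 // pnatr_eq0 -lt0n.
apply: (mulfI n2); rewrite E mulVKf //; congr (_ + _).
apply: eq_big_nat => i i_n; apply: eq_big_nat => j /andP[ij jn].
by rewrite J_eq //; lia.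
Qed.
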